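(* For each $t\ge 1$ and each $t'\ge t$, $$\delta_{t}(\mathbf{\Phi}(t',t))\le 1-\eta_{t}(\mathbf{\Phi}(t',t)).$$
   Context: $G(\mathcal{V},\mathcal{E})$ is a finite directed graph without self-loops, $\mathcal{V}=\{1,\dots,n\}$; $\mathcal{I}_i$ is the set of incoming neighbors of $i$; $f\ge 0$ is an integer with $|\mathcal{I}_i|\ge f$ for all $i$. At most $f$ agents (nodes) crash. $\mathcal{N}[t]\subseteq\mathcal{V}$ is the set of agents that have not crashed by the beginning of iteration $t\ge 1$, and $\bar{\mathcal{N}}[t]=\mathcal{N}[t+1]\subseteq\mathcal{N}[t]$ the set of those that have not crashed by the end of iteration $t$; $\mathcal{N}=\bigcap_{t\ge1}\mathcal{N}[t]$ satisfies $|\mathcal{V}\setminus\mathcal{N}|\le f$. For $i\in\bar{\mathcal{N}}[t]$, $\mathcal{R}_i[t]\subseteq\mathcal{I}_i\cap\mathcal{N}[t]$ is a set with $|\mathcal{R}_i[t]|=|\mathcal{I}_i|-f$ (the agents from which $i$ receives messages in iteration $t$); otherwise arbitrary. For $t\ge1$ the $n\times n$ row-stochastic matrix $\mathbf{A}[t]$ is defined by: for $i\in\bar{\mathcal{N}}[t]$, $\mathbf{A}_{ij}[t]=\frac{1}{|\mathcal{I}_i|-f+1}$ if $j\in\mathcal{R}_i[t]\cup\{i\}$ and $0$ otherwise; for $i\notin\bar{\mathcal{N}}[t]$, $\mathbf{A}_{ii}[t]=1$ and $\mathbf{A}_{ij}[t]=0$ for $j\ne i$. For $t'\ge t\ge 1$,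 $\mathbf{\Phi}(t',t)=\mathbf{A}[t']\mathbf{A}[t'-1]\cdots\mathbf{A}[t]$. For $r\ge1$ define $$\delta_{r}(\mathbf{\Phi}(t',t))=\max_{j\in\mathcal{V}}\max_{i,i'\in\mathcal{N}[r]}\left|\mathbf{\Phi}_{ij}(t',t)-\mathbf{\Phi}_{i'j}(t',t)\right|,\qquad \eta_{r}(\mathbf{\Phi}(t',t))=\min_{i,i'\in\mathcal{N}[r]}\sum_{j\in\mathcal{V}}\min\{\mathbf{\Phi}_{ij}(t',t),\mathbf{\Phi}_{i'j}(t',t)\}.$$ *)

(* Defs.v *)
From HB Require Import structures.
From mathcomp Require Import all_boot all_order all_algebra.
From mathcomp Require Import boolp.

Set Implicit Arguments.
Unset Strict Implicit.
Unset Printing Implicit Defensive.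

Import Order.TTheory GRing.Theory Num.Theory.

Local Open Scope ring_scope.

(* Maximum and minimum of F over a finite set A. They are attained whenever A is
   nonempty (max_overP, min_overP); over the empty set both are 0 by convention. *)
Definition max_over (R : realFieldType) (I : finType) (A : {set I})
    (F : I -> R) : R :=
  if [pick i in A] is Some i0 then F [arg max_(i > i0 in A) F i]%O else 0.

Definition min_over (R : realFieldType) (I : finType) (A : {set I})
    (F : I -> R) : R :=
  if [pick i in A] is Some i0 then F [arg min_(i < i0 in A) F i]%O else 0.

Lemma max_overP (R : realFieldType) (I : finType) (A : {set I}) (F : I -> R) :
  A != set0 ->
  (exists2 i, i \in A & max_over A F = F i) /\
  (forall i, i \in A -> F i <= max_over A F).
Proof.
move=> /set0Pn[x xA]; rewrite /max_over; case: pickP => [i0 i0A|/(_ x)].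
  by case: arg_maxP => // i iA imax; split=> //; exists i.
by rewrite xA.
Qed.

Lemma min_overP (R : realFieldType) (I : finType) (A : {set I}) (F : I -> R) :
  A != set0 ->
  (exists2 i, i \in A & min_over A F = F i) /\
  (forall i, i \in A -> min_over A F <= F i).
Proof.
move=> /set0Pn[x xA]; rewrite /min_over; case: pickP => [i0 i0A|/(_ x)].
  by case: arg_minP => // i iA imin; split=> //; exists i.
by rewrite xA.
Qed.

(* [edge j i] means that j can send messages to i. *)
Definition in_nbrs (n : nat) (edge : rel 'I_n) (i : 'I_n) : {set 'I_n} :=
  [set j | edge j i].

(* [alive t] is the set of nodes not crashed by the beginning of iteration t.
   Iterations are numbered from 1: [alive 0] is meaningless and never used. *)
Definition alive_end (n : nat) (alive : nat -> {set 'I_n}) (t : nat) :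
    {set 'I_n} :=
  alive t.+1.

Definition never_crashed (n : nat) (alive : nat -> {set 'I_n}) : {set 'I_n} :=
  [set i | `[< forall t : nat, (1 <= t)%N -> i \in alive t >]].

Definition crash_pattern (n f : nat) (alive : nat -> {set 'I_n}) : Prop :=
  (forall t : nat, (1 <= t)%N -> alive_end alive t \subset alive t) /\
  (#|~: never_crashed alive| <= f)%N.

(* [recv t i] is the set of nodes whose messages i receives in iteration t; it
   is unconstrained when i crashes before the end of that iteration. *)
Definition reception (n f : nat) (edge : rel 'I_n)
    (alive : nat -> {set 'I_n}) (recv : nat -> 'I_n -> {set 'I_n}) : Prop :=
  forall (t : nat) (i : 'I_n), (1 <= t)%N -> i \in alive_end alive t ->
    recv t i \subset in_nbrs edge i :&: alive t /\
    #|recv t i| = (#|in_nbrs edge i| - f)%N.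

Definition trans_mx (R : realFieldType) (n f : nat) (edge : rel 'I_n)
    (alive : nat -> {set 'I_n}) (recv : nat -> 'I_n -> {set 'I_n})
    (t : nat) : 'M[R]_n :=
  \matrix_(i, j)
    if i \in alive_end alive t then
      if j \in recv t i :|: [set i] then
        1 / (#|in_nbrs edge i| - f + 1)%N%:R
      else 0
    else if j == i then 1 else 0.

(* A t' *m A (t' - 1) *m ... *m A t: later factors stand on the left. *)
Definition Phi (R : realFieldType) (n : nat) (A : nat -> 'M[R]_n)
    (t' t : nat) : 'M[R]_n :=
  \prod_(s <- rev (index_iota t t'.+1)) A s.

Definition delta (R : realFieldType) (n : nat) (alive : nat -> {set 'I_n})
    (r : nat) (M : 'M[R]_n) : R :=
  max_over [set: 'I_n] (fun j =>
    max_over (setX (alive r) (alive r)) (fun p => `|M p.1 j - M p.2 j|)).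

Definition eta (R : realFieldType) (n : nat) (alive : nat -> {set 'I_n})
    (r : nat) (M : 'M[R]_n) : R :=
  min_over (setX (alive r) (alive r)) (fun p =>
    \sum_(j < n) Num.min (M p.1 j) (M p.2 j)).

(* Main.v *)
Require Import Defs.
From mathcomp Require Import all_boot all_order all_algebra.

Set Implicit Arguments.
Unset Strict Implicit.
Unset Printing Implicit Defensive.

Import Order.TTheory GRing.Theory Num.Theory.
Local Open Scope ring_scope.

(** Only the row sums of the matrix matter. If [M] has row sums 1 and, say,
    [M i' j <= M i j], then bounding [min] by the entries of row [i] off column
    [j] gives [\sum_k min (M i k) (M i' k) <= M i' j + (1 - M i j)]. *)

Definition row_sum1 (R : pzSemiRingType) (n : nat) (M : 'M[R]_n) : Prop :=
  forall i, \sum_j M i j = 1.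

Lemma row_sum1_id (R : pzSemiRingType) (n : nat) :
  row_sum1 (1 : 'M[R]_n).
Proof.
move=> i; rewrite (bigD1 i) //= mxE eqxx big1 ?addr0 // => j.
by rewrite mxE eq_sym => /negPf ->.
Qed.

Lemma row_sum1_mul (R : pzSemiRingType) (n : nat) (A B : 'M[R]_n) :
  row_sum1 A -> row_sum1 B -> row_sum1 (A * B).
Proof.
move=> A1 B1 i; under eq_bigr do rewrite mxE.
rewrite exchange_big /= -[RHS](A1 i); apply: eq_bigr => k _.
by rewrite -mulr_sumr B1 mulr1.
Qed.

Lemma row_sum1_Phi (R : realFieldType) (n : nat) (A : nat -> 'M[R]_n)
    (t' t : nat) :
  (forall s, (t <= s)%N -> row_sum1 (A s)) -> row_sum1 (Phi A t' t).
Proof.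
move=> A1; rewrite /Phi big_seq; apply: big_ind => [|B C|s].
- exact: row_sum1_id.
- exact: row_sum1_mul.
- by rewrite mem_rev mem_index_iota => /andP[/A1].
Qed.

(** Without self-loops [i] lies outside [recv t i], so adding it to that set gives exactly as many
    equal entries as the denominator counts. A crashed row is a row of the identity. *)
Lemma row_sum1_trans_mx (R : realFieldType) (n f : nat) (edge : rel 'I_n)
    (alive : nat -> {set 'I_n}) (recv : nat -> 'I_n -> {set 'I_n}) (t : nat) :
  irreflexive edge -> reception f edge alive recv -> (1 <= t)%N ->
  row_sum1 (trans_mx R f edge alive recv t).
Proof.
move=> irr recvP t_ge1 i; under eq_bigr do rewrite mxE.
case i_alive: (i \in alive_end alive t); last by rewrite -big_mkcond /= big_pred1_eq.
have [recv_sub recv_card] := recvP t i t_ge1 i_alive.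
have iNrecv : i \notin recv t i.
  by apply/negP => /(subsetP recv_sub); rewrite !inE irr.
rewrite -big_mkcond /= sumr_const setUC cardsU1 iNrecv recv_card add1n addn1.
by rewrite -[LHS]mulr_natr mul1r mulVf // pnatr_eq0.
Qed.

(** The condition [0 <= c] covers the empty set, where [max_over] is 0. *)
Lemma max_over_le (R : realFieldType) (I : finType) (A : {set I})
    (F : I -> R) (c : R) :
  0 <= c -> (forall i, i \in A -> F i <= c) -> max_over A F <= c.
Proof.
move=> c_ge0 Fc; have [->|/(max_overP F) [[i iA ->] _]] := eqVneq A set0.
  by rewrite /max_over; case: pickP => // i; rewrite inE.
exact: Fc.
Qed.

Lemma sum_min_le (R : realFieldType) (n : nat) (M : 'M[R]_n) (i i' j : 'I_n) :
  row_sum1 M ->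
  \sum_k Num.min (M i k) (M i' k) <= 1 - `|M i j - M i' j|.
Proof.
(* Both sides are symmetric in [i] and [i']. *)
move=> M1; wlog le_i'i : i i' / M i' j <= M i j.
  move=> IH; case/orP: (le_total (M i' j) (M i j)) => /IH // le.
  by rewrite distrC; under eq_bigr do rewrite minC.
rewrite ger0_norm ?subr_ge0 // (bigD1 j) //= min_r // opprB addrCA lerD2l.
(* The column [j] term [M i' j] has cancelled; the remaining bound [1 - M i j] is the sum of row [i]
   off column [j]. *)
rewrite -(M1 i) [in leRHS](bigD1 j) //= addrAC subrr add0r.
by apply: ler_sum => k _; rewrite ge_min lexx.
Qed.

(** Supplies the nonnegative bound that [max_over_le] asks for, including when [alive r] is empty
    and [eta] is 0. *)
Lemma eta_le1 (R : realFieldType) (n : nat) (alive : nat -> {set 'I_n})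
    (r : nat) (M : 'M[R]_n) :
  row_sum1 M -> eta alive r M <= 1.
Proof.
move=> M1; rewrite /eta.
set A := setX _ _; set F := fun _ => _.
have [->|/(min_overP F) [[[i i'] _ ->] _]] := eqVneq A set0.
  by rewrite /min_over; case: pickP => [i|]; rewrite ?inE.
by rewrite (le_trans (sum_min_le i i' i M1)) // gerBl.
Qed.

Lemma delta_le_1_sub_eta (R : realFieldType) (n : nat)
    (alive : nat -> {set 'I_n}) (r : nat) (M : 'M[R]_n) :
  row_sum1 M -> delta alive r M <= 1 - eta alive r M.
Proof.
move=> M1; have eta_ge0 : 0 <= 1 - eta alive r M by rewrite subr_ge0 eta_le1.
apply: max_over_le => // j _; apply: max_over_le => // p pA.
(* Exchanging [eta] with the absolute value leaves [eta] to be compared with the sum of minima for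
   the same pair [p]. *)
rewrite lerBrDr addrC -lerBrDr; apply: le_trans (sum_min_le p.1 p.2 j M1).
have A_neq0 : setX (alive r) (alive r) != set0 by apply/set0Pn; exists p.
exact: (min_overP _ A_neq0).2.
Qed.

Theorem lemma1 (R : realFieldType) (n f : nat) (edge : rel 'I_n)
    (alive : nat -> {set 'I_n}) (recv : nat -> 'I_n -> {set 'I_n})
    (n_gt0 : (0 < n)%N)
    (no_self_loop : irreflexive edge)
    (in_degree : forall i : 'I_n, (f <= #|in_nbrs edge i|)%N)
    (crash : crash_pattern f alive)
    (recvP : reception f edge alive recv)
    (t t' : nat) (t_ge1 : (1 <= t)%N) (t_le_t' : (t <= t')%N) :
  delta alive t (Phi (trans_mx R f edge alive recv) t' t) <=
    1 - eta alive t (Phi (trans_mx R f edge alive recv) t' t).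
Proof.
apply: delta_le_1_sub_eta; apply: row_sum1_Phi => s t_le_s.
(* Every factor of the product has index [s >= t >= 1], the range where [reception] says
   something. *)
by apply: row_sum1_trans_mx => //; apply: leq_trans t_le_s.
Qed.
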